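(* Let $b=(b_{ij})_{i,j=1,2}$ be any $2\times 2$ matrix of constants $b_{ij}\in\mathbb{C}$. Then $e_i\perp e_j=b_{ij}$ defines a solution $\perp$ of the 4-term relations on the exterior algebra $\Omega$ (the $\alpha=1$ calculus on the bicrossproduct spacetime $A$), with $$e_i\perp\mathrm{Vol}=\sum_{j,k}b_{ij}\epsilon_{jk}e_k,\qquad \mathrm{Vol}\perp e_j=\sum_{i,k}b_{ij}\epsilon_{ik}e_k,\qquad \mathrm{Vol}\perp\mathrm{Vol}=\sum_{i,j}\epsilon_{ij}b_{ij}\,\mathrm{Vol}.$$
   Context: Fix a nonzero imaginary $\lambda\in\mathbb{C}$. Let $A$ be the unital associative $\mathbb{C}$-algebra generated by $r,r^{-1},t$ with $rr^{-1}=r^{-1}r=1$ and $[r,t]=\lambda r$. The $\alpha=1$ differential calculus has $\Omega^1$ generated by $\mathrm{d}r,\mathrm{d}t$ with $[t,\mathrm{d}r]=-\lambda\,\mathrm{d}r$, $[t,\mathrm{d}t]=\lambda\,\mathrm{d}t$, $[r,\mathrm{d}r]=[r,\mathrm{d}t]=0$. The 1-forms $e_1=r^{-1}\mathrm{d}r$, $e_2=r\,\mathrm{d}t$ commute with all elements of $A$ and are a free left $A$-basis of $\Omega^1$. The exterior algebra is $\Omega=A\oplus\Omega^1\oplus\Omega^2$ with $e_1^2=e_2^2=0$, $e_1e_2+e_2e_1=0$, and $\Omega^2$ is free over $A$ with central basis $\mathrm{Vol}=e_1e_2=\mathrm{d}r\,\mathrm{d}t$. The symbol $\epsilon_{ij}$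 is antisymmetric with $\epsilon_{12}=1$. A solution of the 4-term relations is a degree $-2$ bilinear map $\perp:\Omega\times\Omega\to\Omega$ (so $\Omega^m\perp\Omega^n\subseteq\Omega^{m+n-2}$) that is an $A$-bimodule map $\Omega\otimes_A\Omega\to\Omega$, satisfies $a\perp\omega=\omega\perp a=0$ for $a\in A$, $\omega\in\Omega$, and for all homogeneous $\omega,\eta,\zeta\in\Omega$ $$(-1)^{|\eta|}(\omega\eta)\perp\zeta+(\omega\perp\eta)\zeta=\omega\perp(\eta\zeta)+(-1)^{|\omega|+|\eta|}\omega(\eta\perp\zeta).$$ *)

(* Defs.v *)
From HB Require Import structures.
From mathcomp Require Import all_boot all_order all_algebra.
From mathcomp Require Import boolp.
From mathcomp Require Import ring.

Set Implicit Arguments.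
Unset Strict Implicit.
Unset Printing Implicit Defensive.

Import GRing.Theory.
Local Open Scope ring_scope.
Local Open Scope quotient_scope.

(* The algebra generated by r, r^-1, t over K, with r r^-1 = r^-1 r = 1 and
   [r, t] = lam r, is the quotient of the noncommutative polynomial
   expressions by the least congruence that contains the axioms of
   associative unital K-algebras and these three relations. *)

Inductive gen := GenR | GenRinv | GenT.

Inductive expr (K : Type) :=
  | Gen of gen
  | Cst of K
  | Add of expr K & expr K
  | Mul of expr K & expr K.
Arguments Gen {K}.

HB.instance Definition _ (K : Type) := gen_eqMixin (expr K).
HB.instance Definition _ (K : Type) := gen_choiceMixin (expr K).

Inductive eqv (K : fieldType) (lam : K) : expr K -> expr K -> Prop :=
  | eqv_refl x : eqv lam x x
  | eqv_sym x y : eqv lam x y -> eqv lam y x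
  | eqv_trans x y z : eqv lam x y -> eqv lam y z -> eqv lam x z
  | eqv_add x x' y y' :
      eqv lam x x' -> eqv lam y y' -> eqv lam (Add x y) (Add x' y')
  | eqv_mul x x' y y' :
      eqv lam x x' -> eqv lam y y' -> eqv lam (Mul x y) (Mul x' y')
  | eqv_addA x y z : eqv lam (Add x (Add y z)) (Add (Add x y) z)
  | eqv_addC x y : eqv lam (Add x y) (Add y x)
  | eqv_add0 x : eqv lam (Add (Cst 0) x) x
  | eqv_addN x : eqv lam (Add (Mul (Cst (-1)) x) x) (Cst 0)
  | eqv_mulA x y z : eqv lam (Mul x (Mul y z)) (Mul (Mul x y) z)
  | eqv_mul1l x : eqv lam (Mul (Cst 1) x) x
  | eqv_mul1r x : eqv lam (Mul x (Cst 1)) x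
  | eqv_mulDl x y z : eqv lam (Mul (Add x y) z) (Add (Mul x z) (Mul y z))
  | eqv_mulDr x y z : eqv lam (Mul x (Add y z)) (Add (Mul x y) (Mul x z))
  | eqv_cstD a b : eqv lam (Cst (a + b)) (Add (Cst a) (Cst b))
  | eqv_cstM a b : eqv lam (Cst (a * b)) (Mul (Cst a) (Cst b))
  | eqv_cstC a x : eqv lam (Mul (Cst a) x) (Mul x (Cst a))
  | eqv_rrV : eqv lam (Mul (Gen GenR) (Gen GenRinv)) (Cst 1)
  | eqv_rVr : eqv lam (Mul (Gen GenRinv) (Gen GenR)) (Cst 1)
  | eqv_rt : eqv lam (Mul (Gen GenR) (Gen GenT))
      (Add (Mul (Gen GenT) (Gen GenR)) (Mul (Cst lam) (Gen GenR))).

Section Bicross.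
Variables (K : fieldType) (lam : K).

Definition eqvb : rel (expr K) := fun x y => `[< eqv lam x y >].

Lemma eqvb_equiv : equiv_class_of eqvb.
Proof.
split=> [x|x y|y x z].
- exact/asboolP/eqv_refl.
- by apply/asboolP/asboolP => /eqv_sym.
- by move=> /asboolP xy /asboolP yz; apply/asboolP/(eqv_trans xy yz).
Qed.

Canonical eqvb_equivRel : equiv_rel (expr K) := EquivRelPack eqvb_equiv.

Definition bicross := {eq_quot eqvb}.
HB.instance Definition _ := Choice.on bicross.
HB.instance Definition _ := Quotient.on bicross.

Definition bpi (x : expr K) : bicross := \pi_bicross x.

Lemma bpiP x y : eqv lam x y <-> bpi x = bpi y.
Proof.
split=> [xy|].
  by apply/eqmodP/asboolP.
by move/eqmodP/asboolP.
Qed.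

Lemma bpiK (a : bicross) : bpi (repr a) = a.
Proof. exact: reprK. Qed.

Lemma bpi_repr x : eqv lam (repr (bpi x)) x.
Proof. by apply/bpiP; rewrite bpiK. Qed.

Definition badd (a b : bicross) := bpi (Add (repr a) (repr b)).
Definition bmul (a b : bicross) := bpi (Mul (repr a) (repr b)).
Definition bopp (a : bicross) := bpi (Mul (Cst (-1)) (repr a)).
Definition bscale (k : K) (a : bicross) := bpi (Mul (Cst k) (repr a)).

Lemma bpi_add x y : badd (bpi x) (bpi y) = bpi (Add x y).
Proof. by apply/bpiP/eqv_add; apply: bpi_repr. Qed.
Lemma bpi_mul x y : bmul (bpi x) (bpi y) = bpi (Mul x y).
Proof. by apply/bpiP/eqv_mul; apply: bpi_repr. Qed.
Lemma bpi_opp x : bopp (bpi x) = bpi (Mul (Cst (-1)) x).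
Proof. by apply/bpiP/eqv_mul; [apply: eqv_refl | apply: bpi_repr]. Qed.
Lemma bpi_scale k x : bscale k (bpi x) = bpi (Mul (Cst k) x).
Proof. by apply/bpiP/eqv_mul; [apply: eqv_refl | apply: bpi_repr]. Qed.

Lemma bicrossW (P : bicross -> Prop) : (forall x, P (bpi x)) -> forall a, P a.
Proof. by move=> Px a; rewrite -(bpiK a). Qed.

Lemma baddA : associative badd.
Proof.
do 3![elim/bicrossW => ?]; rewrite !bpi_add; exact/bpiP/eqv_addA.
Qed.
Lemma baddC : commutative badd.
Proof. do 2![elim/bicrossW => ?]; rewrite !bpi_add; exact/bpiP/eqv_addC. Qed.
Lemma badd0 : left_id (bpi (Cst 0)) badd.
Proof. elim/bicrossW => ?; rewrite bpi_add; exact/bpiP/eqv_add0. Qed.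
Lemma baddN : left_inverse (bpi (Cst 0)) bopp badd.
Proof. elim/bicrossW => ?; rewrite bpi_opp bpi_add; exact/bpiP/eqv_addN. Qed.

HB.instance Definition _ :=
  GRing.isZmodule.Build bicross baddA baddC badd0 baddN.

Lemma bmulA : associative bmul.
Proof.
do 3![elim/bicrossW => ?]; rewrite !bpi_mul; exact/bpiP/eqv_mulA.
Qed.
Lemma bmul1l : left_id (bpi (Cst 1)) bmul.
Proof. elim/bicrossW => ?; rewrite bpi_mul; exact/bpiP/eqv_mul1l. Qed.
Lemma bmul1r : right_id (bpi (Cst 1)) bmul.
Proof. elim/bicrossW => ?; rewrite bpi_mul; exact/bpiP/eqv_mul1r. Qed.
Lemma bmulDl : left_distributive bmul badd.
Proof.
do 3![elim/bicrossW => ?]; rewrite !(bpi_add, bpi_mul); exact/bpiP/eqv_mulDl.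
Qed.
Lemma bmulDr : right_distributive bmul badd.
Proof.
do 3![elim/bicrossW => ?]; rewrite !(bpi_add, bpi_mul); exact/bpiP/eqv_mulDr.
Qed.

(* The algebra is not zero: it acts on the functions int -> K by the shift
   and by the multiplication by lam * n. *)
Fixpoint shift_act (x : expr K) (f : int -> K) (n : int) : K :=
  match x with
  | Gen GenR => f (n + 1)
  | Gen GenRinv => f (n - 1)
  | Gen GenT => lam * n%:~R * f n
  | Cst k => k * f n
  | Add x y => shift_act x f n + shift_act y f n
  | Mul x y => shift_act x (shift_act y f) n
  end.

Lemma shift_act_ext x f g : f =1 g -> shift_act x f =1 shift_act x g.
Proof.
elim: x f g => [[]|k|x IHx y IHy|x IHx y IHy] f g fg n //=; rewrite ?fg //.
  by rewrite (IHx _ _ fg) (IHy _ _ fg).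
exact/IHx/IHy.
Qed.

Lemma shift_act_lin x k f g n :
  shift_act x (fun m => k * f m + g m) n
    = k * shift_act x f n + shift_act x g n.
Proof.
elim: x k f g n => [[]|c|x IHx y IHy|x IHx y IHy] k f g n //=; try by ring.
  by rewrite IHx IHy; ring.
by rewrite -IHx; apply: shift_act_ext => m; rewrite IHy.
Qed.

Lemma shift_act_eqv x y :
  eqv lam x y -> forall f, shift_act x f =1 shift_act y f.
Proof.
elim=> {x y} //=.
- by move=> x y _ IH f n; rewrite IH.
- by move=> x y z _ IH1 _ IH2 f n; rewrite IH1 IH2.
- by move=> x x' y y' _ IH1 _ IH2 f n; rewrite IH1 IH2.
- by move=> x x' y y' _ IH1 _ IH2 f n; rewrite IH1; apply/shift_act_ext/IH2.
- by move=> x y z f n; rewrite addrA.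
- by move=> x y f n; rewrite addrC.
- by move=> x f n; ring.
- by move=> x f n; ring.
- by move=> x f n; rewrite mul1r.
- by move=> x f n; apply: shift_act_ext => m; rewrite mul1r.
- move=> x y z f n; rewrite -[X in _ = X + _]mul1r -shift_act_lin.
  by apply: shift_act_ext => m; rewrite mul1r.
- by move=> a b f n; ring.
- by move=> a b f n; ring.
- move=> k x f n; rewrite -[LHS]addr0.
  have s0 : shift_act x (fun=> 0) n = 0.
    have := shift_act_lin x (-1) f f n; rewrite mulN1r addNr => s0.
    rewrite -[RHS]s0.
    by apply: shift_act_ext => m; rewrite mulN1r addNr.
  by rewrite -s0 -shift_act_lin; apply: shift_act_ext => m; rewrite addr0.
- by move=> f n; rewrite addrK mul1r.
- by move=> f n; rewrite subrK mul1r.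
- by move=> f n; rewrite rmorphD /=; ring.
Qed.

Lemma bicross1_neq0 : bpi (Cst 1) != 0.
Proof.
apply/eqP => /bpiP/shift_act_eqv/(_ (fun=> 1) 0) /= /eqP.
by rewrite mulr1 mulr1 oner_eq0.
Qed.

HB.instance Definition _ :=
  GRing.Zmodule_isNzRing.Build bicross
    bmulA bmul1l bmul1r bmulDl bmulDr bicross1_neq0.

Lemma bscaleA k l a : bscale k (bscale l a) = bscale (k * l) a.
Proof.
elim/bicrossW: a => x; rewrite !bpi_scale; apply/bpiP.
apply: eqv_trans (eqv_mulA _ _ _ _) _; apply: eqv_mul (eqv_refl _ _).
exact/eqv_sym/eqv_cstM.
Qed.
Lemma bscale1 : left_id 1 bscale.
Proof. by elim/bicrossW=> x; rewrite bpi_scale; apply/bpiP/eqv_mul1l. Qed.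
Lemma bscaleDr : right_distributive bscale +%R.
Proof.
move=> k; elim/bicrossW => x; elim/bicrossW => y.
rewrite -[bpi x + bpi y]/(badd (bpi x) (bpi y)) -[RHS]/(badd _ _).
by rewrite !(bpi_scale, bpi_add); apply/bpiP/eqv_mulDr.
Qed.
Lemma bscaleDl a : {morph bscale^~ a : k l / k + l}.
Proof.
move=> k l; elim/bicrossW: a => x; rewrite !bpi_scale [RHS]bpi_add.
by apply/bpiP/(eqv_trans (eqv_mul (eqv_cstD _ _ _) (eqv_refl _ _)))/eqv_mulDl.
Qed.

HB.instance Definition _ :=
  GRing.Zmodule_isLmodule.Build K bicross bscaleA bscale1 bscaleDr bscaleDl.

Lemma bscaleAl (k : K) (a b : bicross) : k *: (a * b) = (k *: a) * b.
Proof.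
elim/bicrossW: a => x; elim/bicrossW: b => y.
by rewrite /GRing.scale /GRing.mul /= !(bpi_scale, bpi_mul);
  apply/bpiP/eqv_mulA.
Qed.
HB.instance Definition _ := GRing.Lmodule_isLalgebra.Build K bicross bscaleAl.

Lemma bscaleAr (k : K) (a b : bicross) : k *: (a * b) = a * (k *: b).
Proof.
elim/bicrossW: a => x; elim/bicrossW: b => y.
rewrite /GRing.scale /GRing.mul /= !(bpi_scale, bpi_mul); apply/bpiP.
apply: eqv_trans (eqv_mulA _ _ _ _) _.
apply: eqv_trans (eqv_mul (eqv_cstC _ _ _) (eqv_refl _ _)) _.
exact/eqv_sym/eqv_mulA.
Qed.
HB.instance Definition _ := GRing.Lalgebra_isAlgebra.Build K bicross bscaleAr.

Definition br : bicross := bpi (Gen GenR).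
Definition brV : bicross := bpi (Gen GenRinv).
Definition bt : bicross := bpi (Gen GenT).

Lemma bpiD x y : bpi (Add x y) = bpi x + bpi y.
Proof. by rewrite [RHS]bpi_add. Qed.
Lemma bpiM x y : bpi (Mul x y) = bpi x * bpi y.
Proof. by rewrite [RHS]bpi_mul. Qed.
Lemma bpi0 : bpi (Cst 0) = 0. Proof. by []. Qed.
Lemma bpi_cst k : bpi (Cst k) = k%:A.
Proof.
by rewrite /GRing.scale /= /GRing.one /= bpi_scale;
  apply/bpiP/eqv_sym/eqv_mul1r.
Qed.

Lemma br_brV : br * brV = 1.
Proof. by rewrite -bpiM; apply/bpiP/eqv_rrV. Qed.
Lemma brV_br : brV * br = 1.
Proof. by rewrite -bpiM; apply/bpiP/eqv_rVr. Qed.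
Lemma br_bt : br * bt - bt * br = lam *: br.
Proof.
have /bpiP := eqv_rt lam; rewrite bpiD !bpiM bpi_cst -/br -/bt => ->.
by rewrite addrC addKr mulr_algl.
Qed.
Lemma brV_bt : brV * bt - bt * brV = - (lam *: brV).
Proof.
have : brV * (br * bt - bt * br) * brV = brV * (lam *: br) * brV.
  by rewrite br_bt.
rewrite mulrBr mulrBl !mulrA brV_br mul1r -!mulrA br_brV mulr1.
rewrite -scalerAl br_brV -scalerAr mulr1 => <-.
by rewrite opprB.
Qed.

End Bicross.

Arguments br {K lam}.
Arguments brV {K lam}.
Arguments bt {K lam}.

(* The exterior algebra.  Form a f1 f2 v is a + f1 e_1 + f2 e_2 + v Vol; the
   product is the one for which e_1, e_2 commute with A, square to zero and
   anticommute, with e_1 e_2 = Vol. *)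
Record omega (K : fieldType) (lam : K) := Form {
  fun0 : bicross lam;
  coef1 : bicross lam;
  coef2 : bicross lam;
  coefV : bicross lam }.

Section Omega.
Variables (K : fieldType) (lam : K).
Notation A := (bicross lam).
Notation Omega := (omega lam).

Definition omega_code (x : Omega) := (fun0 x, coef1 x, coef2 x, coefV x).
Definition omega_decode (c : A * A * A * A) : Omega :=
  let: (a, f1, f2, v) := c in Form a f1 f2 v.
Lemma omega_codeK : cancel omega_code omega_decode. Proof. by case. Qed.
HB.instance Definition _ := Choice.copy Omega (can_type omega_codeK).

Lemma formP (x y : Omega) :
  [/\ fun0 x = fun0 y, coef1 x = coef1 y, coef2 x = coef2 y
    & coefV x = coefV y] -> x = y.
Proof. by case: x y => [????] [????] /= [-> -> -> ->]. Qed.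

Definition oadd (x y : Omega) : Omega :=
  Form (fun0 x + fun0 y) (coef1 x + coef1 y) (coef2 x + coef2 y)
       (coefV x + coefV y).
Definition oopp (x : Omega) : Omega :=
  Form (- fun0 x) (- coef1 x) (- coef2 x) (- coefV x).
Definition oscale (k : K) (x : Omega) : Omega :=
  Form (k *: fun0 x) (k *: coef1 x) (k *: coef2 x) (k *: coefV x).
Definition omul (x y : Omega) : Omega :=
  Form (fun0 x * fun0 y)
       (fun0 x * coef1 y + coef1 x * fun0 y)
       (fun0 x * coef2 y + coef2 x * fun0 y)
       (fun0 x * coefV y + coef1 x * coef2 y - coef2 x * coef1 y
        + coefV x * fun0 y).

Lemma oaddA : associative oadd.
Proof. by move=> x y z; apply: formP; split; apply: addrA. Qed.
Lemma oaddC : commutative oadd.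
Proof. by move=> x y; apply: formP; split; apply: addrC. Qed.
Lemma oadd0 : left_id (Form 0 0 0 0) oadd.
Proof. by move=> x; apply: formP; split; apply: add0r. Qed.
Lemma oaddN : left_inverse (Form 0 0 0 0) oopp oadd.
Proof. by move=> x; apply: formP; split; apply: addNr. Qed.
HB.instance Definition _ := GRing.isZmodule.Build Omega oaddA oaddC oadd0 oaddN.

Lemma omulA : associative omul.
Proof.
move=> x y z; apply: formP; split=> /=;
  rewrite ?(mulrDl, mulrDr, mulrBl, mulrBr, mulNr, mulrN) ?mulrA //.
- by rewrite !addrA.
- by rewrite !addrA.
rewrite !opprD !addrA; exact: (ACl (1*2*5*3*7*4*6*8*9)).
Qed.

Lemma omul1l : left_id (Form 1 0 0 0) omul.
Proof.
by move=> x; apply: formP; split;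
  rewrite /= ?mul1r ?mul0r ?subr0 ?addr0.
Qed.
Lemma omul1r : right_id (Form 1 0 0 0) omul.
Proof.
by move=> x; apply: formP; split;
  rewrite /= ?mulr1 ?mulr0 ?subr0 ?add0r.
Qed.
Lemma omulDl : left_distributive omul oadd.
Proof.
move=> x y z; apply: formP; split=> /=; rewrite !mulrDl ?opprD ?addrA //.
- exact: (ACl (1*3*2*4)).
- exact: (ACl (1*3*2*4)).
- exact: (ACl (1*3*5*7*2*4*6*8)).
Qed.
Lemma omulDr : right_distributive omul oadd.
Proof.
move=> x y z; apply: formP; split=> /=; rewrite !mulrDr ?opprD ?addrA //.
- exact: (ACl (1*3*2*4)).
- exact: (ACl (1*3*2*4)).
- exact: (ACl (1*3*5*7*2*4*6*8)).
Qed.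
Lemma omega1_neq0 : Form 1 0 0 0 != 0 :> Omega.
Proof. by apply/eqP => -[] /eqP; rewrite oner_eq0. Qed.
HB.instance Definition _ :=
  GRing.Zmodule_isNzRing.Build Omega
    omulA omul1l omul1r omulDl omulDr omega1_neq0.

Lemma oscaleA k l x : oscale k (oscale l x) = oscale (k * l) x.
Proof. by apply: formP; split; apply: scalerA. Qed.
Lemma oscale1 : left_id 1 oscale.
Proof. by move=> x; apply: formP; split; apply: scale1r. Qed.
Lemma oscaleDr : right_distributive oscale +%R.
Proof. by move=> k x y; apply: formP; split; apply: scalerDr. Qed.
Lemma oscaleDl x : {morph oscale^~ x : k l / k + l}.
Proof. by move=> k l; apply: formP; split; apply: scalerDl. Qed.
HB.instance Definition _ :=
  GRing.Zmodule_isLmodule.Build K Omega oscaleA oscale1 oscaleDr oscaleDl.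

Lemma oscaleAl (k : K) (x y : Omega) : k *: (x * y) = (k *: x) * y.
Proof.
by apply: formP; split;
  rewrite /= ?(scalerDr, scalerN, scalerBr) ?scalerAl.
Qed.
HB.instance Definition _ := GRing.Lmodule_isLalgebra.Build K Omega oscaleAl.
Lemma oscaleAr (k : K) (x y : Omega) : k *: (x * y) = x * (k *: y).
Proof.
by apply: formP; split;
  rewrite /= ?(scalerDr, scalerN, scalerBr) ?scalerAr.
Qed.
HB.instance Definition _ := GRing.Lalgebra_isAlgebra.Build K Omega oscaleAr.

Definition inA (a : A) : Omega := Form a 0 0 0.

Lemma inA_is_additive : additive inA.
Proof. by move=> a b; apply: formP; split; rewrite /= ?subr0. Qed.
Lemma inA_is_monoid_morphism : monoid_morphism inA.
Proof.
split=> [|a b] //; apply: formP; split;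
  by rewrite /= ?(mul0r, mulr0, subr0, addr0).
Qed.
Lemma inA_is_scalable : scalable inA.
Proof. by move=> k a; apply: formP; split; rewrite /= ?scaler0. Qed.
HB.instance Definition _ := GRing.isZmodMorphism.Build A Omega inA inA_is_additive.
HB.instance Definition _ :=
  GRing.isMonoidMorphism.Build A Omega inA inA_is_monoid_morphism.
HB.instance Definition _ :=
  GRing.isScalable.Build K A Omega *:%R inA inA_is_scalable.

(* Omega^m; the degree is an integer, and Omega^m = 0 unless 0 <= m <= 2. *)
Definition homog (m : int) (x : Omega) : Prop :=
  match m with
  | Posz 0 => [/\ coef1 x = 0, coef2 x = 0 & coefV x = 0]
  | Posz 1 => fun0 x = 0 /\ coefV x = 0
  | Posz 2 => [/\ fun0 x = 0, coef1 x = 0 & coef2 x = 0]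
  | _ => x = 0
  end.

(* The exterior derivative.  On A it is da = pd1 a e_1 + pd2 a e_2, where pd1
   and pd2 are the derivations given on r, r^-1, t by e_1 = r^-1 dr and
   e_2 = r dt; on 1-forms it is extended by de_1 = 0 and de_2 = dr dt = Vol. *)
Section Derivation.
Variable D : gen -> A.

Fixpoint dexpr (x : expr K) : A :=
  match x with
  | Gen g => D g
  | Cst _ => 0
  | Add x y => dexpr x + dexpr y
  | Mul x y => dexpr x * bpi lam y + bpi lam x * dexpr y
  end.

Definition deriv (a : A) : A := dexpr (repr a).

Hypothesis D_rrV : D GenR * brV + br * D GenRinv = 0.
Hypothesis D_rVr : D GenRinv * br + brV * D GenR = 0.
Hypothesis D_rt :
  D GenR * bt + br * D GenT = D GenT * br + bt * D GenR + lam *: D GenR.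

Lemma dexpr_eqv x y : eqv lam x y -> dexpr x = dexpr y.
Proof.
elim=> {x y} //=.
- by move=> x y z _ -> _ ->.
- by move=> x x' y y' _ -> _ ->.
- by move=> x x' y y' /bpiP -> -> /bpiP -> ->.
- by move=> x y z; rewrite addrA.
- by move=> x y; rewrite addrC.
- by move=> x; rewrite add0r.
- by move=> x; rewrite mul0r add0r bpi_cst scaleN1r mulN1r addNr.
- by move=> x y z; rewrite !bpiM mulrDl mulrDr !mulrA addrA.
- by move=> x; rewrite mul0r add0r bpi_cst scale1r mul1r.
- by move=> x; rewrite mulr0 addr0 bpi_cst scale1r mulr1.
- by move=> x y z; rewrite !bpiD !mulrDl !addrA; exact: (ACl (1*3*2*4)).
- by move=> x y z; rewrite !bpiD !mulrDr !addrA; exact: (ACl (1*3*2*4)).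
- by move=> _ _; rewrite addr0.
- by move=> a b; rewrite mul0r mulr0 addr0.
- by move=> k x; rewrite !mul0r !mulr0 add0r addr0 bpi_cst mulr_algl mulr_algr.
- by rewrite bpi_cst mul0r add0r mulr_algl.
Qed.

Lemma derivE x : deriv (bpi lam x) = dexpr x.
Proof. exact/dexpr_eqv/bpi_repr. Qed.
Lemma derivD a b : deriv (a + b) = deriv a + deriv b.
Proof.
by elim/bicrossW: a => x; elim/bicrossW: b => y; rewrite -bpiD !derivE.
Qed.
Lemma derivM a b : deriv (a * b) = deriv a * b + a * deriv b.
Proof.
by elim/bicrossW: a => x; elim/bicrossW: b => y; rewrite -bpiM !derivE.
Qed.
Lemma derivZ k a : deriv (k *: a) = k *: deriv a.
Proof.
elim/bicrossW: a => x; rewrite -mulr_algl -bpi_cst -bpiM !derivE /=.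
by rewrite mul0r add0r bpi_cst mulr_algl.
Qed.
End Derivation.


Definition gen1 (g : gen) : A :=
  match g with GenR => br | GenRinv => - brV | GenT => 0 end.
Definition gen2 (g : gen) : A :=
  match g with GenR => 0 | GenRinv => 0 | GenT => brV end.
Definition pd1 : A -> A := deriv gen1.
Definition pd2 : A -> A := deriv gen2.

Lemma gen1_rrV : gen1 GenR * brV + br * gen1 GenRinv = 0.
Proof. by rewrite /= mulrN subrr. Qed.
Lemma gen1_rVr : gen1 GenRinv * br + brV * gen1 GenR = 0.
Proof. by rewrite /= mulNr addNr. Qed.
Lemma gen1_rt : gen1 GenR * bt + br * gen1 GenT
  = gen1 GenT * br + bt * gen1 GenR + lam *: gen1 GenR.
Proof. by rewrite /= mul0r mulr0 addr0 add0r -br_bt addrC subrK. Qed.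
Lemma gen2_rrV : gen2 GenR * brV + br * gen2 GenRinv = 0.
Proof. by rewrite /= mul0r mulr0 addr0. Qed.
Lemma gen2_rVr : gen2 GenRinv * br + brV * gen2 GenR = 0.
Proof. by rewrite /= mul0r mulr0 addr0. Qed.
Lemma gen2_rt : gen2 GenR * bt + br * gen2 GenT
  = gen2 GenT * br + bt * gen2 GenR + lam *: gen2 GenR.
Proof. by rewrite /= mul0r mulr0 scaler0 addr0 add0r addr0 br_brV brV_br. Qed.

Lemma pd1E x : pd1 (bpi lam x) = dexpr gen1 x.
Proof. exact: derivE gen1_rrV gen1_rVr gen1_rt _. Qed.
Lemma pd1D a b : pd1 (a + b) = pd1 a + pd1 b.
Proof. exact: derivD gen1_rrV gen1_rVr gen1_rt _ _. Qed.
Lemma pd1M a b : pd1 (a * b) = pd1 a * b + a * pd1 b.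
Proof. exact: derivM gen1_rrV gen1_rVr gen1_rt _ _. Qed.
Lemma pd1Z c a : pd1 (c *: a) = c *: pd1 a.
Proof. exact: derivZ gen1_rrV gen1_rVr gen1_rt _ _. Qed.
Lemma pd2E x : pd2 (bpi lam x) = dexpr gen2 x.
Proof. exact: derivE gen2_rrV gen2_rVr gen2_rt _. Qed.
Lemma pd2D a b : pd2 (a + b) = pd2 a + pd2 b.
Proof. exact: derivD gen2_rrV gen2_rVr gen2_rt _ _. Qed.
Lemma pd2M a b : pd2 (a * b) = pd2 a * b + a * pd2 b.
Proof. exact: derivM gen2_rrV gen2_rVr gen2_rt _ _. Qed.
Lemma pd2Z c a : pd2 (c *: a) = c *: pd2 a.
Proof. exact: derivZ gen2_rrV gen2_rVr gen2_rt _ _. Qed.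

Lemma pd1_0 : pd1 0 = 0. Proof. by rewrite -bpi0 pd1E. Qed.
Lemma pd2_0 : pd2 0 = 0. Proof. by rewrite -bpi0 pd2E. Qed.
Lemma pd1N a : pd1 (- a) = - pd1 a.
Proof. by rewrite -scaleN1r pd1Z scaleN1r. Qed.
Lemma pd2N a : pd2 (- a) = - pd2 a.
Proof. by rewrite -scaleN1r pd2Z scaleN1r. Qed.
Lemma pd1_r : pd1 br = br. Proof. exact: pd1E. Qed.
Lemma pd1_rV : pd1 brV = - brV. Proof. exact: pd1E. Qed.
Lemma pd1_t : pd1 bt = 0. Proof. exact: pd1E. Qed.
Lemma pd2_r : pd2 br = 0. Proof. exact: pd2E. Qed.
Lemma pd2_rV : pd2 brV = 0. Proof. exact: pd2E. Qed.
Lemma pd2_t : pd2 bt = brV. Proof. exact: pd2E. Qed.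

Lemma pd_comm a : pd1 (pd2 a) - pd2 (pd1 a) + pd2 a = 0.
Proof.
elim/bicrossW: a; elim=> [[]|k|x IHx y IHy|x IHx y IHy].
- by rewrite -/br pd1_r !pd2_r pd1_0 subrr addr0.
- by rewrite -/brV pd1_rV pd2N !pd2_rV pd1_0 oppr0 subrr addr0.
- by rewrite -/bt pd1_t !pd2_t pd1_rV pd2_0 subr0 addNr.
- by rewrite pd2E /= pd1E /= pd1_0  pd2_0 subrr addr0.
- rewrite bpiD !(pd1D, pd2D) opprD.
  rewrite -[RHS]addr0 -{1}IHx -IHy !addrA.
  exact: (ACl (1*3*5*2*4*6)).
set a := bpi lam x in IHx *; set b := bpi lam y in IHy *.
have Ha : pd1 (pd2 a) = pd2 (pd1 a) - pd2 a.
  by apply/eqP; rewrite -subr_eq0 opprB addrCA addrC IHx.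
have Hb : pd1 (pd2 b) = pd2 (pd1 b) - pd2 b.
  by apply/eqP; rewrite -subr_eq0 opprB addrCA addrC IHy.
rewrite bpiM -/a -/b !(pd1M, pd2M, pd1D, pd2D) Ha Hb.
rewrite mulrBl mulrBr; set u := pd2 (pd1 a) * b; set v := pd2 a * b.
set w := pd2 a * pd1 b; set u' := a * pd2 (pd1 b); set v' := a * pd2 b.
set w' := pd1 a * pd2 b.
rewrite !opprD !addrA.
rewrite [LHS](ACl ((1*7)*(11*2)*(3*9)*(4*8)*(5*10)*(12*6)))/=.
by rewrite !subrr !addr0.
Qed.

Definition d (x : Omega) : Omega :=
  Form 0 (pd1 (fun0 x)) (pd2 (fun0 x))
       (pd1 (coef2 x) - pd2 (coef1 x) + coef2 x).

Definition dr : Omega := d (inA br).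
Definition dt : Omega := d (inA bt).

(* The index type 'I_2 counts from 0, so e ord0 is e_1 and e ord_max is e_2. *)
Definition e (i : 'I_2) : Omega :=
  if i == ord0 then inA brV * dr else inA br * dt.
Definition Vol : Omega := e ord0 * e ord_max.

Definition eps (i j : 'I_2) : K :=
  if (i < j)%N then 1 else if (j < i)%N then -1 else 0.

Lemma drE : dr = Form 0 br 0 0.
Proof.
by apply: formP; split=> //=; rewrite ?pd1_r ?pd2_r ?pd1_0 ?pd2_0 ?subrr ?addr0.
Qed.
Lemma dtE : dt = Form 0 0 brV 0.
Proof.
by apply: formP; split=> //=; rewrite ?pd1_t ?pd2_t ?pd1_0 ?pd2_0 ?subrr ?addr0.
Qed.
Lemma e1E : e ord0 = Form 0 1 0 0.
Proof.
rewrite /e eqxx drE; apply: formP; split=> /=;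
  by rewrite ?(mulr0, mul0r, brV_br, subrr, addr0).
Qed.
Lemma e2E : e ord_max = Form 0 0 1 0.
Proof.
rewrite (_ : e ord_max = inA br * dt) // dtE; apply: formP; split=> /=;
  by rewrite ?(mulr0, mul0r, br_brV, subrr, addr0).
Qed.
Lemma VolE : Vol = Form 0 0 0 1.
Proof.
by rewrite /Vol e1E e2E; apply: formP; split=> /=;
  rewrite ?(mulr0, mul0r, mulr1, subr0, addr0, add0r).
Qed.

(* 1, e_1, e_2 and Vol are a basis of Omega over A: fun0, ..., coefV are the
   coordinates. *)
Lemma omega_basis (x : Omega) :
  x = inA (fun0 x) + inA (coef1 x) * e ord0 + inA (coef2 x) * e ord_max
      + inA (coefV x) * Vol.
Proof.
by rewrite e1E e2E VolE; apply: formP; split=> /=;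
  rewrite ?(mulr0, mul0r, mulr1, mul1r, scaler0, oppr0, addr0, add0r).
Qed.

Lemma e_central i a : inA a * e i = e i * inA a.
Proof.
suff {i} : inA a * e ord0 = e ord0 * inA a /\
           inA a * e ord_max = e ord_max * inA a.
  case=> H0 H1; case: i => -[|[|//]] Hi.
    by rewrite (_ : Ordinal Hi = ord0) //; apply: val_inj.
  by rewrite (_ : Ordinal Hi = ord_max) //; apply: val_inj.
by rewrite e1E e2E; split; apply: formP; split=> /=;
  rewrite ?(mulr0, mul0r, mulr1, mul1r, scaler0, oppr0, addr0, add0r).
Qed.

Lemma t_dr : inA bt * dr - dr * inA bt = - (lam *: dr).
Proof.
rewrite drE; apply: formP; split=> /=;
  rewrite ?(mulr0, mul0r, mulr1, mul1r, scaler0, oppr0, addr0, add0r) //.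
by rewrite -opprB br_bt.
Qed.
Lemma t_dt : inA bt * dt - dt * inA bt = lam *: dt.
Proof.
rewrite dtE; apply: formP; split=> /=;
  rewrite ?(mulr0, mul0r, mulr1, mul1r, scaler0, oppr0, addr0, add0r) //.
by rewrite -opprB brV_bt opprK.
Qed.
Lemma r_dr : inA br * dr = dr * inA br.
Proof.
by rewrite drE; apply: formP; split=> /=;
  rewrite ?(mulr0, mul0r, mulr1, mul1r, scaler0, oppr0, addr0, add0r).
Qed.
Lemma r_dt : inA br * dt = dt * inA br.
Proof.
by rewrite dtE; apply: formP; split=> /=;
  rewrite ?(mulr0, mul0r, mulr1, mul1r, scaler0, oppr0, addr0, add0r, br_brV, brV_br).
Qed.
Lemma e_sq i : e i * e i = 0.
Proof.
rewrite /e; case: ifP => _; rewrite -/dr -/dt ?drE ?dtE; apply: formP; split=> /=;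
  by rewrite ?(mulr0, mul0r, mulr1, mul1r, scaler0, oppr0, addr0, add0r).
Qed.
Lemma e_anticomm : e ord0 * e ord_max + e ord_max * e ord0 = 0.
Proof.
rewrite e1E e2E; apply: formP; split=> /=;
  by rewrite ?(mulr0, mul0r, mulr1, mul1r, scaler0, oppr0, addr0, add0r, subrr).
Qed.
Lemma dr_dt : dr * dt = Vol.
Proof.
rewrite VolE drE dtE; apply: formP; split=> /=;
  by rewrite ?(mulr0, mul0r, mulr1, mul1r, scaler0, oppr0, addr0, add0r, br_brV).
Qed.

Lemma d_linear : linear d.
Proof.
move=> k x y; apply: formP; split=> /=.
- by rewrite scaler0 addr0.
- by rewrite pd1D pd1Z.
- by rewrite pd2D pd2Z.
rewrite pd1D pd2D pd1Z pd2Z !scalerDr scalerN opprD !addrA.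
exact: (ACl (1*3*5*2*4*6)).
Qed.

Lemma d_d x : d (d x) = 0.
Proof.
apply: formP; split=> //=; first exact: pd1_0.
  exact: pd2_0.
exact: pd_comm.
Qed.

Lemma d0 : d 0 = 0.
Proof. by apply: formP; split; rewrite /= ?pd1_0 ?pd2_0 ?subr0 ?addr0. Qed.

Lemma d_leibniz (m : nat) x y :
  homog m x -> d (x * y) = d x * y + (-1) ^+ m * (x * d y).
Proof.
case: x => a f1 f2 v.
case: m => [|[|[|m]]] /=; last first.
- by move=> ->; rewrite mul0r d0 !mul0r mulr0 addr0.
- case=> -> -> ->; apply: formP.
  by rewrite expr2 mulN1r opprK mul1r; split=> /=;
    rewrite ?(mul0r, mulr0, pd1_0, pd2_0, add0r, addr0, subrr, oppr0).
- case=> -> ->; rewrite expr1 mulN1r; apply: formP; split=> /=;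
    rewrite ?(mul0r, mulr0, pd1_0, pd2_0, add0r, addr0, subr0, sub0r, oppr0) //.
  rewrite pd1M pd2M !mulrDl mulNr opprB opprD !addrA.
  exact: (ACl (1*3*5*2*4)).
case=> -> -> ->; rewrite expr0 mul1r; apply: formP; split=> /=;
  rewrite ?(mul0r, mulr0, pd1_0, pd2_0, add0r, addr0, subr0, sub0r, oppr0) //.
- by rewrite pd1M addrC.
- by rewrite pd2M addrC.
rewrite pd1M pd2M !mulrDr mulrN !opprD !addrA.
exact: (ACl (1*3*2*4*5)).
Qed.

Record four_term_solution (perp : Omega -> Omega -> Omega) : Prop := {
  perp_linear_l : forall y, linear (perp^~ y);
  perp_linear_r : forall x, linear (perp x);
  perp_degree : forall (m n : int) x y,
    homog m x -> homog n y -> homog (m + n - 2) (perp x y);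
  perp_A_l : forall a x y, perp (inA a * x) y = inA a * perp x y;
  perp_A_r : forall a x y, perp x (y * inA a) = perp x y * inA a;
  perp_A_balanced : forall a x y, perp (x * inA a) y = perp x (inA a * y);
  perp_fun_l : forall a y, perp (inA a) y = 0;
  perp_fun_r : forall x a, perp x (inA a) = 0;
  perp_four_term : forall (m n p : nat) x y z,
    homog m x -> homog n y -> homog p z ->
    (-1) ^+ n * perp (x * y) z + perp x y * z
      = perp x (y * z) + (-1) ^+ (m + n) * (x * perp y z) }.

End Omega.

(* Main.v *)
From Pilot Require Import Defs.
From mathcomp Require Import all_boot all_order all_algebra.
From mathcomp Require Import reals.
From mathcomp Require Import complex.
Import GRing.Theory.
Local Open Scope ring_scope.
Local Open Scope complex_scope.

(** A bimodule map on the free A-bimodule Omega is determined by its values on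
    the central basis 1, e_1, e_2, Vol. For a solution, the 4-term relation on
    (e_1, e_1, e_2), (e_2, e_2, e_1), (e_1, e_2, e_2), (e_2, e_1, e_1) and
    (e_1, e_2, Vol) computes the values involving Vol from the constants
    b_ij. Conversely, the bilinear extension of these values satisfies the
    relation: it is immediate when one argument has degree 0, and a comparison
    of coefficients on the basis in the remaining degrees. *)

(** * Two-valued indices and cancellation in noncommutative algebras *)

Lemma ord2P (i : 'I_2) : i = ord0 \/ i = ord_max.
Proof. by case: i => -[|[|//]] Hi; [left|right]; apply: val_inj. Qed.

Lemma sum_ord2 (V : zmodType) (F : 'I_2 -> V) :
  \sum_(i < 2) F i = F ord0 + F ord_max.
Proof.
rewrite big_ord_recr big_ord1 /=.
by congr (F _ + _); apply: val_inj.
Qed.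

(** The leading [0 +] keeps a term in front of the last pair of opposites, so that [addrK] or
    [subrK] still matches when [noncomm_eq] cancels it. *)
Lemma eq_of_sub0 (V : zmodType) (x y : V) : 0 + (x - y) = 0 -> x = y.
Proof. by rewrite add0r => /eqP; rewrite subr_eq0 => /eqP. Qed.

(* Decides equations between sums of monomials [k *: m] in a noncommutative
   algebra: after expansion every monomial becomes an atom, and the last term
   of the difference is repeatedly cancelled against its opposite. *)
Ltac noncomm_eq :=
  apply: eq_of_sub0;
  rewrite ?(mulrDl, mulrDr, mulNr, mulrN) ?(opprD, opprK);
  rewrite ?(scalerDr, scalerDl, scalerN, scaleNr);
  rewrite -?scalerAl -?scalerAr ?mulrA ?opprD ?opprK ?addrA;
  repeat match goal with
  | |- context [@GRing.scale ?R ?V ?k ?m] => move: (@GRing.scale R V k m) => ?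
  end;
  repeat match goal with
  | |- _ - ?t = 0 => rewrite -!addrA ?(addrC t) !addrA (addrK t, subrK t)
  | |- _ + ?t = 0 => rewrite -!addrA ?(addrC (- t)) !addrA (addrK t, subrK t)
  end.

(** * Coordinate identities behind the 4-term relation *)

Section Coefficients.
Variables (K : comNzRingType) (A : algType K) (b11 b12 b21 b22 : K).
Variables (f1 f2 g1 g2 h1 h2 u : A).

(** Every monomial on either side is a product of an f, a g and an h in this order, so nothing in
    [A] has to commute. This is the e_1 coordinate of the 4-term relation on three 1-forms with
    coordinates f, g, h; [coef2_four_term] is its e_2 coordinate. *)
Lemma coef1_four_term :
  - - (b21 *: ((f1 * g2 - f2 * g1) * h1) + b22 *: ((f1 * g2 - f2 * g1) * h2))
  + (b11 *: (f1 * g1) + b12 *: (f1 * g2)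
     + b21 *: (f2 * g1) + b22 *: (f2 * g2)) * h1
  = - (b12 *: (f1 * (g1 * h2 - g2 * h1)) + b22 *: (f2 * (g1 * h2 - g2 * h1)))
  + f1 * (b11 *: (g1 * h1) + b12 *: (g1 * h2)
          + b21 *: (g2 * h1) + b22 *: (g2 * h2)).
Proof. by noncomm_eq. Qed.

Lemma coef2_four_term :
  - (b11 *: ((f1 * g2 - f2 * g1) * h1) + b12 *: ((f1 * g2 - f2 * g1) * h2))
  + (b11 *: (f1 * g1) + b12 *: (f1 * g2)
     + b21 *: (f2 * g1) + b22 *: (f2 * g2)) * h2
  = b11 *: (f1 * (g1 * h2 - g2 * h1)) + b21 *: (f2 * (g1 * h2 - g2 * h1))
  + f2 * (b11 *: (g1 * h1) + b12 *: (g1 * h2)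
          + b21 *: (g2 * h1) + b22 *: (g2 * h2)).
Proof. by noncomm_eq. Qed.

(** Here and in the next two lemmas the suffix lists the degrees of the three arguments, and [u] is
    the Vol coordinate of the 2-form among them. *)
Lemma coefV_four_term_112 :
  - ((b12 - b21) *: ((f1 * g2 - f2 * g1) * u))
  + (b11 *: (f1 * g1) + b12 *: (f1 * g2)
     + b21 *: (f2 * g1) + b22 *: (f2 * g2)) * u
  = f1 * (b11 *: (g1 * u) + b21 *: (g2 * u))
    - f2 * - (b12 *: (g1 * u) + b22 *: (g2 * u)).
Proof. by noncomm_eq. Qed.

Lemma coefV_four_term_121 :
  - (b12 *: (f1 * u) + b22 *: (f2 * u)) * g2
  - (b11 *: (f1 * u) + b21 *: (f2 * u)) * g1
  = - (f1 * (b11 *: (u * g1) + b12 *: (u * g2))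
       - f2 * - (b21 *: (u * g1) + b22 *: (u * g2))).
Proof. by noncomm_eq. Qed.

Lemma coefV_four_term_211 :
  - (b21 *: (u * f1) + b22 *: (u * f2)) * g2
  - (b11 *: (u * f1) + b12 *: (u * f2)) * g1
  = (b12 - b21) *: (u * (f1 * g2 - f2 * g1))
  - u * (b11 *: (f1 * g1) + b12 *: (f1 * g2)
     + b21 *: (f2 * g1) + b22 *: (f2 * g2)).
Proof. by noncomm_eq. Qed.

End Coefficients.

(** * The candidate solution in coordinates and its 4-term relation *)

Section Perp.
Set Implicit Arguments.
Unset Strict Implicit.
(* MathComp has a [coef1] of its own, which shadows the one of Defs. *)
Import Pilot.Defs.
Variables (K : fieldType) (lam : K).
Notation Omega := (omega lam).
Notation A := (bicross lam).
Notation e1 := (e lam ord0).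
Notation e2 := (e lam ord_max).
Notation Vol := (Vol lam).
Implicit Types (a f g v w : A) (x y z : Omega).

Definition oneform f g : Omega := Form 0 f g 0.
Definition twoform v : Omega := Form 0 0 0 v.

Lemma homog0 (m : int) : homog m (0 : Omega).
Proof. by case: m => [[|[|[|m]]]|m]. Qed.

Lemma homog0E x : homog 0 x -> x = inA (fun0 x).
Proof. by case: x => a f g v /= [-> -> ->]. Qed.

Lemma homog1E x : homog 1 x -> x = oneform (coef1 x) (coef2 x).
Proof. by case: x => a f g v /= [-> ->]. Qed.

Lemma homog2E x : homog 2 x -> x = twoform (coefV x).
Proof. by case: x => a f g v /= [-> -> ->]. Qed.

Ltac omega_eq :=
  apply: formP; split=> /=;
  rewrite ?(mul0r, mulr0, mul1r, mulr1, scaler0, oppr0, addr0, add0r) //.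

Lemma inA_twoform a v : inA a * twoform v = twoform (a * v).
Proof. by omega_eq. Qed.
Lemma twoform_inA a v : twoform v * inA a = twoform (v * a).
Proof. by omega_eq. Qed.
Lemma inA_oneform a f g : inA a * oneform f g = oneform (a * f) (a * g).
Proof. by omega_eq. Qed.
Lemma oneform_inA a f g : oneform f g * inA a = oneform (f * a) (g * a).
Proof. by omega_eq. Qed.
Lemma oneform_oneform f1 f2 g1 g2 :
  oneform f1 f2 * oneform g1 g2 = twoform (f1 * g2 - f2 * g1).
Proof. by omega_eq. Qed.
Lemma oneform_twoform f g v : oneform f g * twoform v = 0.
Proof. by omega_eq. Qed.
Lemma twoform_oneform f g v : twoform v * oneform f g = 0.
Proof. by omega_eq. Qed.
Lemma twoform_twoform v w : twoform v * twoform w = 0.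
Proof. by omega_eq. Qed.
Lemma oneformD f1 f2 g1 g2 :
  oneform f1 f2 + oneform g1 g2 = oneform (f1 + g1) (f2 + g2).
Proof. by omega_eq. Qed.
Lemma oneformN f g : - oneform f g = oneform (- f) (- g).
Proof. by omega_eq. Qed.
Lemma twoformD v w : twoform v + twoform w = twoform (v + w).
Proof. by omega_eq. Qed.
Lemma twoformN v : - twoform v = twoform (- v).
Proof. by omega_eq. Qed.

Definition omul_homogE := (inA_twoform, twoform_inA, inA_oneform, oneform_inA,
  oneform_oneform, oneform_twoform, twoform_oneform, twoform_twoform).

Variable b : 'M[K]_2.
Notation b11 := (b ord0 ord0).
Notation b12 := (b ord0 ord_max).
Notation b21 := (b ord_max ord0).
Notation b22 := (b ord_max ord_max).

(** Bilinear extension of the values e_i ⊥ e_j = b_ij, e_i ⊥ Vol = b_i1 e_2 - b_i2 e_1, Vol ⊥ e_j =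
    b_1j e_2 - b_2j e_1 and Vol ⊥ Vol = (b_12 - b_21) Vol. As the basis is central, coordinates of
    [x] and [y] simply multiply, in this order. *)
Definition perp_of x y : Omega := Form
  (b11 *: (coef1 x * coef1 y) + b12 *: (coef1 x * coef2 y)
   + b21 *: (coef2 x * coef1 y) + b22 *: (coef2 x * coef2 y))
  (- (b12 *: (coef1 x * coefV y) + b22 *: (coef2 x * coefV y)
      + b21 *: (coefV x * coef1 y) + b22 *: (coefV x * coef2 y)))
  (b11 *: (coef1 x * coefV y) + b21 *: (coef2 x * coefV y)
   + b11 *: (coefV x * coef1 y) + b12 *: (coefV x * coef2 y))
  ((b12 - b21) *: (coefV x * coefV y)).

Lemma perp_of_e i j : perp_of (e lam i) (e lam j) = (b i j)%:A.
Proof.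
by case: (ord2P i) => ->; case: (ord2P j) => ->; rewrite ?e1E ?e2E; omega_eq.
Qed.

Lemma perp_of0l y : perp_of 0 y = 0.
Proof. by omega_eq. Qed.
Lemma perp_of0r x : perp_of x 0 = 0.
Proof. by omega_eq. Qed.
Lemma perp_of_fun_l a y : perp_of (inA a) y = 0.
Proof. by omega_eq. Qed.
Lemma perp_of_fun_r x a : perp_of x (inA a) = 0.
Proof. by omega_eq. Qed.

Lemma perp_of_11 f1 f2 g1 g2 :
  perp_of (oneform f1 f2) (oneform g1 g2)
  = inA (b11 *: (f1 * g1) + b12 *: (f1 * g2)
         + b21 *: (f2 * g1) + b22 *: (f2 * g2)).
Proof. by omega_eq. Qed.
Lemma perp_of_12 f1 f2 v :
  perp_of (oneform f1 f2) (twoform v)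
  = oneform (- (b12 *: (f1 * v) + b22 *: (f2 * v)))
            (b11 *: (f1 * v) + b21 *: (f2 * v)).
Proof. by omega_eq. Qed.
Lemma perp_of_21 g1 g2 v :
  perp_of (twoform v) (oneform g1 g2)
  = oneform (- (b21 *: (v * g1) + b22 *: (v * g2)))
            (b11 *: (v * g1) + b12 *: (v * g2)).
Proof. by omega_eq. Qed.
Lemma perp_of_22 v w :
  perp_of (twoform v) (twoform w) = twoform ((b12 - b21) *: (v * w)).
Proof. by omega_eq. Qed.

Definition perp_of_homogE := (perp_of_fun_l, perp_of_fun_r, perp_of0l,
  perp_of0r, perp_of_11, perp_of_12, perp_of_21, perp_of_22).

Lemma perp_of_A_l a x y : perp_of (inA a * x) y = inA a * perp_of x y.
Proof.
apply: formP; split=> /=;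
  by rewrite ?(mul0r, addr0, oppr0) ?(mulrN, mulrDr) -?scalerAr ?mulrA.
Qed.

Lemma perp_of_A_r a x y : perp_of x (y * inA a) = perp_of x y * inA a.
Proof.
apply: formP; split=> /=;
  by rewrite ?(mulr0, add0r, oppr0) ?(mulNr, mulrDl) -?scalerAl ?mulrA.
Qed.

Lemma perp_of_A_balanced a x y : perp_of (x * inA a) y = perp_of x (inA a * y).
Proof.
by apply: formP; split=> /=; rewrite ?(mulr0, mul0r, add0r, addr0, oppr0) ?mulrA.
Qed.

Lemma perp_of_linear_l y : linear (perp_of^~ y).
Proof.
move=> k x x'; apply: formP; split=> /=;
  (* [k] and b_ij are merged into one scalar in a fixed order, so that equal monomials become the
     same atom for [noncomm_eq]. *)
  rewrite ?mulrDl -?scalerAl ?scalerDr ?scalerN ?scalerDr ?scalerA ?(mulrC k);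
  by noncomm_eq.
Qed.

Lemma perp_of_linear_r x : linear (perp_of x).
Proof.
move=> k y y'; apply: formP; split=> /=;
  rewrite ?mulrDr -?scalerAr ?scalerDr ?scalerN ?scalerDr ?scalerA ?(mulrC k);
  by noncomm_eq.
Qed.

Lemma perp_of_degree (m n : int) x y :
  homog m x -> homog n y -> homog (m + n - 2) (perp_of x y).
Proof.
case: m => [[|[|[|m]]]|m];
  (* [homog] forces a form of degree outside 0, 1, 2 to vanish, which leaves nine pairs of
     degrees. *)
  try (by move=> -> _; rewrite perp_of0l; apply: homog0);
case: n => [[|[|[|n]]]|n];
  try (by move=> _ ->; rewrite perp_of0r; apply: homog0);
  by do 2![move/homog0E=> -> | move/homog1E=> -> | move/homog2E=> ->];
  rewrite perp_of_homogE.
Qed.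

Lemma perp_of_four_term (m n p : nat) x y z :
    homog m x -> homog n y -> homog p z ->
    (-1) ^+ n * perp_of (x * y) z + perp_of x y * z
      = perp_of x (y * z) + (-1) ^+ (m + n) * (x * perp_of y z).
Proof.
case: m => [|[|[|m]]]; last 1 first.
- by move=> -> _ _; rewrite !(mul0r, mulr0, perp_of0l, addr0).
(* With the first argument in [A] the relation is left [A]-linearity; below, the middle one in [A]
   gives balancedness and the last one right [A]-linearity. *)
- move/homog0E=> -> _ _; move: (fun0 x) => a.
  rewrite perp_of_A_l !perp_of_fun_l mul0r addr0 add0r add0n !mulrA.
  congr (_ * _); exact/commrX/commrN1.
all: case: n => [|[|[|n]]]; last 1 first.
all: try by move=> _ -> _; rewrite !(mul0r, mulr0, perp_of0l, perp_of0r, addr0).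
all: try by move=> _ /homog0E -> _; rewrite perp_of_A_balanced perp_of_fun_r
  perp_of_fun_l mul0r !mulr0 mul1r.
all: case: p => [|[|[|p]]]; last 1 first.
all: try by move=> _ _ ->; rewrite !(mulr0, perp_of0r, addr0).
all: try by move=> _ _ /homog0E ->; rewrite !perp_of_fun_r perp_of_A_r !mulr0
  addr0 add0r.
all: do 3![move/homog1E=> -> | move/homog2E=> ->].
(* Both sides have degree m + n + p - 2, so they vanish unless m + n + p is at most 4. The degrees
   111, 112, 121 and 211 remain. *)
all: rewrite ?(omul_homogE, perp_of_homogE) ?mulr0 ?mul0r ?addr0 ?add0r //.
all: rewrite ?(exprS, expr0, mulr1, mulN1r, opprK, mul1r).
all: rewrite ?(oneformN, twoformN, oneformD, twoformD).
- by congr oneform; [apply: coef1_four_term | apply: coef2_four_term].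
- by congr twoform; apply: coefV_four_term_112.
- by congr twoform; apply: coefV_four_term_121.
- by congr twoform; apply: coefV_four_term_211.
Qed.

Lemma perp_of_solution : four_term_solution perp_of.
Proof.
split.
- exact: perp_of_linear_l.
- exact: perp_of_linear_r.
- exact: perp_of_degree.
- exact: perp_of_A_l.
- exact: perp_of_A_r.
- exact: perp_of_A_balanced.
- exact: perp_of_fun_l.
- exact: perp_of_fun_r.
- exact: perp_of_four_term.
Qed.

End Perp.

(** * Values on Vol forced by the 4-term relation *)

Section Solution.
Set Implicit Arguments.
Unset Strict Implicit.
Import Pilot.Defs.
Variables (K : fieldType) (lam : K).
Notation Omega := (omega lam).
Notation A := (bicross lam).
Notation e1 := (e lam ord0).
Notation e2 := (e lam ord_max).
Notation Vol := (Vol lam).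
Implicit Types (a : A) (x y : Omega) (perp : Omega -> Omega -> Omega).

Section Values.
Variable perp : Omega -> Omega -> Omega.
Hypothesis sol : four_term_solution perp.

Lemma solution0l y : perp 0 y = 0.
Proof. exact: (perp_fun_l sol 0). Qed.
Lemma solution0r x : perp x 0 = 0.
Proof. exact: (perp_fun_r sol x 0). Qed.
Lemma solutionDl x x' y : perp (x + x') y = perp x y + perp x' y.
Proof. by have := perp_linear_l sol y 1 x x'; rewrite !scale1r. Qed.
Lemma solutionDr x y y' : perp x (y + y') = perp x y + perp x y'.
Proof. by have := perp_linear_r sol x 1 y y'; rewrite !scale1r. Qed.
Lemma solutionNl x y : perp (- x) y = - perp x y.
Proof. by apply/eqP; rewrite -addr_eq0 -solutionDl addNr solution0l. Qed.
Lemma solutionNr x y : perp x (- y) = - perp x y.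
Proof. by apply/eqP; rewrite -addr_eq0 -solutionDr addNr solution0r. Qed.

Lemma homog_e i : homog 1%N (e lam i).
Proof. by case: (ord2P i) => ->; rewrite ?e1E ?e2E. Qed.
Lemma homog_Vol : homog 2%N Vol.
Proof. by rewrite VolE. Qed.
Lemma e2_e1 : e2 * e1 = - Vol.
Proof. by apply/eqP; rewrite -addr_eq0 addrC; apply/eqP/e_anticomm. Qed.

Variable b : 'M[K]_2.
Hypothesis perp_e : forall i j, perp (e lam i) (e lam j) = (b i j)%:A.

(** When two adjacent indices coincide, e_i e_i = 0 kills one of the two [perp] terms, and the other
    one, a value on Vol up to sign when the third index differs, is expressed by [b]. *)
Lemma solution_e_e_e i j k :
  b i j *: e lam k - perp (e lam i * e lam j) (e lam k)
  = perp (e lam i) (e lam j * e lam k) + b j k *: e lam i.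
Proof.
have := perp_four_term sol (homog_e i) (homog_e j) (homog_e k).
by rewrite !perp_e expr1 mulN1r sqrrN expr1n mul1r mulr_algl mulr_algr addrC.
Qed.

Lemma solution_e_Vol i :
  perp (e lam i) Vol
  = \sum_(j < 2) \sum_(k < 2) (b i j * eps K j k) *: e lam k.
Proof.
rewrite !sum_ord2 /eps /= !mulr0 !scale0r addr0 add0r mulr1 mulrN1 scaleNr.
case: (ord2P i) => ->.
- have := solution_e_e_e ord0 ord0 ord_max.
  by rewrite e_sq solution0l subr0 => ->; rewrite addrK.
- have := solution_e_e_e ord_max ord_max ord0.
  rewrite e_sq solution0l subr0 e2_e1 solutionNr => ->.
  by rewrite opprD opprK addrCA subrr addr0.
Qed.

Lemma solution_Vol_e j :
  perp Vol (e lam j)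
  = \sum_(i < 2) \sum_(k < 2) (b i j * eps K i k) *: e lam k.
Proof.
rewrite !sum_ord2 /eps /= !mulr0 !scale0r addr0 add0r mulr1 mulrN1 scaleNr.
case: (ord2P j) => ->.
- have := solution_e_e_e ord_max ord0 ord0.
  rewrite e_sq solution0r add0r e2_e1 solutionNl opprK => <-.
  by rewrite addrC addKr.
- have := solution_e_e_e ord0 ord_max ord_max.
  by rewrite e_sq solution0r add0r => <-; rewrite opprB addrC subrK.
Qed.

Lemma solution_Vol_Vol :
  perp Vol Vol = (\sum_(i < 2) \sum_(j < 2) eps K i j * b i j) *: Vol.
Proof.
have := perp_four_term sol (homog_e ord0) (homog_e ord_max) homog_Vol.
have -> : e2 * Vol = 0.
  by rewrite -[Vol]opprK -e2_e1 mulrN mulrA e_sq mul0r oppr0.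
rewrite perp_e solution_e_Vol !sum_ord2 /eps /= !mulr0 !mul0r !scale0r.
rewrite expr1 sqrrN expr1n !addr0 !add0r !mul1r mulr1 !mulN1r mulrN1.
(* In e_1 (e_2 ⊥ Vol) the e_1 component of e_2 ⊥ Vol dies by e_1 e_1 = 0, leaving b_21 Vol. *)
rewrite mulr_algl mulrDr -!scalerAr e_sq scaler0 addr0 scalerBl.
by rewrite solution0r add0r => <-; rewrite opprD opprK addrCA subrr addr0.
Qed.

End Values.

(** * Uniqueness of the solution *)

Lemma Vol_central a : inA a * Vol = Vol * inA a.
Proof. by rewrite mulrA e_central -mulrA e_central mulrA. Qed.

(** Centrality of the basis allows writing [x] with coefficients on the left and [y] with
    coefficients on the right; the bimodule property pulls both out, and the components in [A]
    contribute 0. *)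
Lemma solution_unique perp perp' :
  four_term_solution perp -> four_term_solution perp' ->
  {in [:: e1; e2; Vol] &, forall x y, perp x y = perp' x y} ->
  forall x y, perp x y = perp' x y.
Proof.
move=> sol sol' eq_perp x y.
have eq_r u : u \in [:: e1; e2; Vol] -> perp u y = perp' u y.
  move=> us; rewrite (omega_basis y) !e_central Vol_central.
  rewrite !(solutionDr sol) !(solutionDr sol') !(perp_A_r sol) !(perp_A_r sol').
  rewrite (perp_fun_r sol) (perp_fun_r sol').
  by rewrite !(eq_perp _ _ us) ?inE ?eqxx ?orbT.
have eq_l a u : u \in [:: e1; e2; Vol] ->
    perp (inA a * u) y = perp' (inA a * u) y.
  by move=> us; rewrite (perp_A_l sol) (perp_A_l sol') eq_r.
rewrite (omega_basis x) !(solutionDl sol) !(solutionDl sol').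
congr (_ + _ + _ + _); first by rewrite (perp_fun_l sol) (perp_fun_l sol').
all: by apply: eq_l; rewrite !inE eqxx ?orbT.
Qed.

End Solution.

Theorem lemma3p1 (R : realType) (lam : R[i]) (hlam0 : lam <> 0)
    (hlam : complex.Re lam = 0) (b : 'M[R[i]]_2) :
  exists perp : omega lam -> omega lam -> omega lam,
    [/\ four_term_solution perp /\ (forall i j, perp (e lam i) (e lam j) = (b i j)%:A),
        forall perp' : omega lam -> omega lam -> omega lam,
          four_term_solution perp' ->
          (forall i j, perp' (e lam i) (e lam j) = (b i j)%:A) ->
          forall x y, perp' x y = perp x y,
        forall i, perp (e lam i) (Vol lam)
          = \sum_(j < 2) \sum_(k < 2) (b i j * eps _ j k) *: e lam k,
        forall j, perp (Vol lam) (e lam j)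
          = \sum_(i < 2) \sum_(k < 2) (b i j * eps _ i k) *: e lam k
      & perp (Vol lam) (Vol lam)
          = (\sum_(i < 2) \sum_(j < 2) eps _ i j * b i j) *: Vol lam].
Proof.
have sol := perp_of_solution lam b; have perp_e := perp_of_e lam b.
exists (perp_of b); split=> //.
- move=> perp' sol' perp'_e; apply: (solution_unique sol' sol) => x y.
  (* On each of the nine pairs of basis forms both solutions take the value determined by [b]. *)
  rewrite !inE => /or3P[] /eqP-> /or3P[] /eqP->;
    by rewrite ?perp'_e ?perp_e // ?(solution_e_Vol sol' perp'_e)
      ?(solution_e_Vol sol perp_e) ?(solution_Vol_e sol' perp'_e)
      ?(solution_Vol_e sol perp_e) ?(solution_Vol_Vol sol' perp'_e)
      ?(solution_Vol_Vol sol perp_e).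
- exact: (solution_e_Vol sol perp_e).
- exact: (solution_Vol_e sol perp_e).
- exact: (solution_Vol_Vol sol perp_e).
Qed.
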